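(* $\mathrm{UCL}_\mathbb{R}\not\le_W\mathrm{BWT}_\mathbb{R}$, $\mathrm{BWT}_\mathbb{R}\not\le_W\mathrm{UCL}_\mathbb{R}$, $\mathrm{CL}_\mathbb{N}\not\le_W\mathrm{BWT}_\mathbb{R}$ and $\mathrm{BWT}_\mathbb{R}\not\le_W\mathrm{CL}_\mathbb{N}$.
   Context: A representation of a set $X$ is a surjective partial function $\delta:\subseteq\mathbb{N}^\mathbb{N}\to X$. For $f:\subseteq(X,\delta_X)\rightrightarrows(Y,\delta_Y)$ a realizer is a single-valued partial $F$ on Baire space with $\delta_Y(F(p))\in f(\delta_X(p))$ for all $p\in\mathrm{dom}(f\circ\delta_X)$ ($F\vdash f$). With $\langle p,q\rangle(2n)=p(n)$, $\langle p,q\rangle(2n+1)=q(n)$: $f\le_W g$ iff there are computable partial $H,K$ on Baire space such that $p\mapsto H\langle p,G(K(p))\rangle$ realizes $f$ for every $G\vdash g$. $\mathbb{R}$ has the Cauchy representation $\delta(p)=\lim_m\overline{p(m)}$ for $p$ with $|\overline{p(m)}-\overline{p(k)}|<2^{-m}$ ($k>m$), $\overline{i}$ the $i$-th rational; $\mathbb{N}$ is represented by $p\mapsto p(0)$; sequence spaces $X^\mathbb{N}$ by $\langle p_0,p_1,\ldots\rangle\mapsto(\delta_X(p_i))_i$, where $\langle p_0,p_1,\ldots\rangle(\langle i,j\rangle)=p_i(j)$ for a standard pairing. $\mathrm{BWT}_\mathbb{R}$ maps a bounded sequence of reals to any of its cluster points; $\mathrm{UCL}_\mathbb{R}$ maps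 a sequence of reals with exactly one cluster point to that cluster point; $\mathrm{CL}_\mathbb{N}$ maps a sequence of natural numbers in which some number occurs infinitely often to any number that occurs infinitely often in it. *)

(* Defs.v *)
From Stdlib Require Import Reals QArith Qreals Lra Lia Arith Cantor.
From Stdlib Require Import ClassicalEpsilon FunctionalExtensionality.

Open Scope nat_scope.

Definition baire : Type := nat -> nat.

Notation "⟨ a , b ⟩" := (Cantor.to_nat (a, b)) (format "⟨ a ,  b ⟩").

Record pfun (A B : Type) : Type := Pfun {
  graph :> A -> B -> Prop;
  graph_fun : forall a b b', graph a b -> graph a b' -> b = b'
}.
Arguments Pfun {A B} _ _.
Arguments graph {A B} _ _ _.

(** Codes for the unary partial recursive functions with an oracle; tuples are
    passed through the Cantor pairing, so that [cPair cLeft cRight] is the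
    identity. *)
Inductive code : Type :=
  | cZero | cSucc | cLeft | cRight | cOracle
  | cPair (f g : code)
  | cComp (f g : code)
  | cPrec (f g : code)
  | cMu (f : code).

(** [eval p c a b]: the function coded by [c] with oracle [p] is defined at [a]
    with value [b].  In [eval_mu], [v] lists the predecessors of the (nonzero)
    values of [f] at the arguments below the least zero [n]. *)
Inductive eval (p : baire) : code -> nat -> nat -> Prop :=
  | eval_zero a : eval p cZero a 0
  | eval_succ a : eval p cSucc a (S a)
  | eval_left a b : eval p cLeft ⟨a, b⟩ a
  | eval_right a b : eval p cRight ⟨a, b⟩ b
  | eval_oracle a : eval p cOracle a (p a)
  | eval_pair f g a b c :
      eval p f a b -> eval p g a c -> eval p (cPair f g) a ⟨b, c⟩
  | eval_comp f g a b c :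
      eval p g a b -> eval p f b c -> eval p (cComp f g) a c
  | eval_prec0 f g a b :
      eval p f a b -> eval p (cPrec f g) ⟨a, 0⟩ b
  | eval_precS f g a n b c :
      eval p (cPrec f g) ⟨a, n⟩ b -> eval p g ⟨a, ⟨n, b⟩⟩ c ->
      eval p (cPrec f g) ⟨a, S n⟩ c
  | eval_mu f a n (v : nat -> nat) :
      (forall m, m < n -> eval p f ⟨a, m⟩ (S (v m))) ->
      eval p f ⟨a, n⟩ 0 ->
      eval p (cMu f) a n.

(** As usual for Type-2 machines, the behaviour outside the domain of [F] is
    left unconstrained. *)
Definition computable (F : pfun baire baire) : Prop :=
  exists c : code, forall p q, F p q -> forall n, eval p c n (q n).

Record repspace : Type := Repspace {
  carrier :> Type;
  delta : pfun baire carrier;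
  delta_surj : forall x, exists p, delta p x
}.
Arguments Repspace {carrier} _ _.
Arguments delta {_}.

Definition nat_delta : pfun baire nat.
Proof.
  refine (Pfun (fun p n => p 0 = n) _).
  intros; congruence.
Defined.

Lemma nat_delta_surj (n : nat) : exists p, nat_delta p n.
Proof. now exists (fun _ => n). Qed.

Definition nat_space : repspace := Repspace nat_delta nat_delta_surj.

(** The rational with index [⟨⟨a, b⟩, k⟩] is (a - b) / (k + 1). *)
Definition rat (i : nat) : Q :=
  let (u, k) := Cantor.of_nat i in
  let (a, b) := Cantor.of_nat u in
  Qmake (Z.of_nat a - Z.of_nat b) (Pos.of_succ_nat k).

Definition ratR (i : nat) : R := Q2R (rat i).

Definition real_delta : pfun baire R.
Proof.
  refine (Pfun (fun p x =>
    (forall m k, m < k -> (Rabs (ratR (p m) - ratR (p k)) < / 2 ^ m)%R)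
    /\ Un_cv (fun m => ratR (p m)) x) _).
  intros p x y [_ Hx] [_ Hy]; exact (UL_sequence _ _ _ Hx Hy).
Defined.

Lemma ratR_dense (x eps : R) :
  (0 < eps)%R -> exists i, (Rabs (ratR i - x) < eps)%R.
Proof.
  intros He.
  destruct (archimed_cor1 eps He) as [[|N] [HN HN0]]; [lia|].
  set (z := up (x * INR (S N))).
  exists ⟨⟨Z.to_nat z, Z.to_nat (- z)⟩, N⟩.
  unfold ratR, rat; rewrite !Cantor.cancel_of_to.
  replace (Z.of_nat (Z.to_nat z) - Z.of_nat (Z.to_nat (- z)))%Z with z by lia.
  unfold Q2R; cbn [Qnum Qden].
  replace (IZR (Z.pos (Pos.of_succ_nat N))) with (INR (S N))
    by (now rewrite INR_IZR_INZ).
  destruct (archimed (x * INR (S N))) as [H1 H2]; fold z in H1, H2.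
  assert (HS : (0 < INR (S N))%R) by (apply lt_0_INR; lia).
  replace (IZR z * / INR (S N) - x)%R
    with ((IZR z - x * INR (S N)) * / INR (S N))%R by (field; lra).
  assert (HI : (0 < / INR (S N))%R) by now apply Rinv_0_lt_compat.
  rewrite Rabs_pos_eq by (apply Rmult_le_pos; lra).
  apply Rle_lt_trans with (1 * / INR (S N))%R; [|lra].
  apply Rmult_le_compat_r; lra.
Qed.

Lemma real_delta_surj (x : R) : exists p, real_delta p x.
Proof.
  assert (Hp : forall m, (0 < / 2 ^ m)%R)
    by (intros m; apply Rinv_0_lt_compat, pow_lt; lra).
  assert (He : forall m, exists i, (Rabs (ratR i - x) < / 2 ^ m / 2)%R)
    by (intros m; apply ratR_dense; specialize (Hp m); lra).
  pose (p := fun m => proj1_sig (constructive_indefinite_description _ (He m))).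
  assert (H : forall m, (Rabs (ratR (p m) - x) < / 2 ^ m / 2)%R)
    by (intros m; exact (proj2_sig (constructive_indefinite_description _ (He m)))).
  exists p; split.
  - intros m k Hmk.
    assert (Hle : (/ 2 ^ k <= / 2 ^ m)%R).
    { apply Rinv_le_contravar; [apply pow_lt; lra|apply Rle_pow; [lra|lia]]. }
    pose proof (H m) as H1; pose proof (H k) as H2.
    apply Rabs_def2 in H1; apply Rabs_def2 in H2; apply Rabs_def1; lra.
  - intros eps Heps.
    destruct (pow_lt_1_zero (/ 2)) with (y := eps) as [N HN];
      [rewrite Rabs_pos_eq; lra|exact Heps|].
    exists N; intros n Hn; specialize (HN n Hn); unfold Rdist.
    rewrite pow_inv, Rabs_pos_eq in HN by (specialize (Hp n); lra).
    specialize (H n); specialize (Hp n); lra.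
Qed.

Definition real_space : repspace := Repspace real_delta real_delta_surj.

Definition seq_delta (X : repspace) : pfun baire (nat -> X).
Proof.
  refine (Pfun (fun p x => forall i, delta (fun j => p ⟨i, j⟩) (x i)) _).
  intros p x y Hx Hy; apply functional_extensionality; intros i.
  exact (graph_fun _ _ _ _ _ _ (Hx i) (Hy i)).
Defined.

Lemma seq_delta_surj (X : repspace) (x : nat -> X) : exists p, seq_delta X p x.
Proof.
  pose (q := fun i =>
    constructive_indefinite_description _ (delta_surj X (x i))).
  exists (fun n => let (i, j) := Cantor.of_nat n in proj1_sig (q i) j).
  intros i.
  replace (fun j => _) with (proj1_sig (q i)).
  - exact (proj2_sig (q i)).
  - apply functional_extensionality; intros j; now rewrite Cantor.cancel_of_to.
Qed.

Definition seq_space (X : repspace) : repspace :=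
  Repspace (seq_delta X) (seq_delta_surj X).

(** A partial multi-valued function is identified with its graph; its domain is
    the set of points with at least one value. *)
Definition mvfun (X Y : repspace) : Type := X -> Y -> Prop.

Definition dom {X Y : repspace} (f : mvfun X Y) (x : X) : Prop :=
  exists y, f x y.

Definition realizes {X Y : repspace} (F : pfun baire baire) (f : mvfun X Y) :
    Prop :=
  forall p x, delta p x -> dom f x ->
  exists q y, F p q /\ delta q y /\ f x y.

Definition interleave (p q : baire) : baire :=
  fun n => if Nat.even n then p (Nat.div2 n) else q (Nat.div2 n).

(** The partial function p ↦ H⟨p, G(K(p))⟩. *)
Definition weihrauch_comp (H G K : pfun baire baire) : pfun baire baire.
Proof.
  refine (Pfun (fun p r =>
    exists k q, K p k /\ G k q /\ H (interleave p q) r) _).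
  intros p r r' (k & q & Hk & Hq & Hr) (k' & q' & Hk' & Hq' & Hr').
  rewrite (graph_fun _ _ _ _ _ _ Hk' Hk) in Hq'.
  rewrite (graph_fun _ _ _ _ _ _ Hq' Hq) in Hr'.
  exact (graph_fun _ _ _ _ _ _ Hr Hr').
Defined.

Definition weihrauch_le {X Y Z W : repspace} (f : mvfun X Y) (g : mvfun Z W) :
    Prop :=
  exists H K : pfun baire baire,
    computable H /\ computable K /\
    forall G : pfun baire baire,
      realizes G g -> realizes (weihrauch_comp H G K) f.

Notation "f ≤W g" := (weihrauch_le f g) (at level 70, no associativity).

Definition bounded_seq (x : nat -> R) : Prop :=
  exists M : R, forall n, (Rabs (x n) <= M)%R.

(** [ValAdh x y]: [y] is a cluster point of the sequence [x]. *)
Definition BWT_R : mvfun (seq_space real_space) real_space :=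
  fun (x : nat -> R) (y : R) => bounded_seq x /\ ValAdh x y.

Definition UCL_R : mvfun (seq_space real_space) real_space :=
  fun (x : nat -> R) (y : R) => ValAdh x y /\ forall z, ValAdh x z -> z = y.

Definition CL_N : mvfun (seq_space nat_space) nat_space :=
  fun (x : nat -> nat) (n : nat) => forall N, exists k, N <= k /\ x k = n.

Lemma dom_BWT_R (x : nat -> R) : dom BWT_R x <-> bounded_seq x.
Proof.
  split; [now intros [y [Hb _]]|].
  intros [M HM].
  destruct (Bolzano_Weierstrass x (fun c => - M <= c <= M)%R) as [y Hy].
  - apply compact_P3.
  - intros n; specialize (HM n); revert HM.
    unfold Rabs; destruct (Rcase_abs (x n)); lra.
  - exists y; split; [now exists M|exact Hy].
Qed.

(* Main.v *)
Require Import Defs.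
From Stdlib Require Import Reals ZArith Lra Lia Cantor List ClassicalEpsilon.
From Stdlib Require Import FunctionalExtensionality.

(** Only the continuity of computable functionals matters. Reductions are
    refuted by instances that are generic for forcing with conditions made of a
    finite stem and a set to which all later entries are confined; the part of
    the outcome that a finite computation can reveal is decided by a condition.

    - [CL_N] and [UCL_R] against [BWT_R]: in a generic sequence [0] is the only
      recurrent number. The cluster points of the bounded inner sequence form a
      compact set, so finitely many prefixes of names suffice for the answer
      [0], and a condition keeps the inner sequence in the corresponding
      neighbourhoods. Continuing with a fresh constant makes this answer wrong.
    - [BWT_R] against [CL_N]: a solution of the inner instance is one of
      countably many numbers, and each of them is defeated by confining the
      sequence to a smaller interval.
    - [BWT_R] against [UCL_R]: if some condition forced the inner sequence to
      return to a ball for ever, then a finite prefix of a generic sequence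
      would determine both a neighbourhood that the inner sequence cannot leave
      within the ball and an interval that the answer avoids; confining the
      sequence to this interval gives a wrong answer. So the inner sequence of a
      generic sequence leaves every ball and has no cluster point. *)

Open Scope nat_scope.

Local Opaque Cantor.to_nat.

(** * Continuous partial functionals *)

Definition agree (l : nat) (p q : baire) : Prop := forall m, m < l -> p m = q m.

Lemma agree_refl (l : nat) (p : baire) : agree l p p.
Proof. now intros m Hm. Qed.

Lemma agree_trans (l : nat) (p q r : baire) :
  agree l p q -> agree l q r -> agree l p r.
Proof. intros Hpq Hqr m Hm; now rewrite Hpq, Hqr. Qed.

Lemma agree_le (l l' : nat) (p q : baire) : l <= l' -> agree l' p q -> agree l p q.
Proof. intros Hl Hpq m Hm; apply Hpq; lia. Qed.

Definition baire_open (U : baire -> Prop) : Prop :=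
  forall p, U p -> exists l, forall q, agree l p q -> U q.

Lemma baire_open_Forall {I : Type} (U : I -> baire -> Prop) (is : list I) :
  (forall i, baire_open (U i)) -> baire_open (fun p => Forall (fun i => U i p) is).
Proof.
  intros HU p; induction is as [|i is IH]; intros Hp; [now exists 0|].
  apply Forall_cons_iff in Hp as [Hi His].
  destruct (HU i p Hi) as [l Hl], (IH His) as [l' Hl'].
  exists (max l l'); intros q Hq; constructor; [apply Hl|apply Hl'];
    (apply agree_le with (max l l'); [lia|exact Hq]).
Qed.

(** A partial functional on Baire space is given by the graphs of the entries of
    its values. *)
Definition functional : Type := baire -> nat -> nat -> Prop.

Definition maps (A : functional) (p q : baire) : Prop := forall n, A p n (q n).

Definition continuous (A : functional) : Prop :=
  (forall p n b b', A p n b -> A p n b' -> b = b') /\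
  forall n b, baire_open (fun p => A p n b).

Definition takes_value (A : functional) (P : nat -> nat -> Prop) (p : baire) :
    Prop :=
  exists n b, P n b /\ A p n b.

Lemma takes_value_open (A : functional) (P : nat -> nat -> Prop) :
  continuous A -> baire_open (takes_value A P).
Proof.
  intros [_ Aopen] p (n & b & HP & Hb); destruct (Aopen _ _ _ Hb) as [l Hl].
  exists l; intros q Hq; exists n, b; auto.
Qed.

Lemma takes_value_maps (A : functional) (P : nat -> nat -> Prop) (p q : baire) :
  continuous A -> maps A p q -> takes_value A P p <-> exists n, P n (q n).
Proof.
  intros [Adet _] HA; split.
  - intros (n & b & HP & Hb); exists n; now rewrite (Adet p n (q n) b (HA n) Hb).
  - intros [n HP]; exists n, (q n); auto.
Qed.

Definition continuous2 (B : baire -> functional) : Prop :=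
  (forall p r n b b', B p r n b -> B p r n b' -> b = b') /\
  forall p r n b, B p r n b ->
    exists l, forall p' r', agree l p p' -> agree l r r' -> B p' r' n b.

Lemma continuous2_section (B : baire -> functional) (r : baire) :
  continuous2 B -> continuous (fun p => B p r).
Proof.
  intros [Bdet Bloc]; split; [intros p; apply Bdet|].
  intros n b p Hb; destruct (Bloc _ _ _ _ Hb) as [l Hl].
  exists l; intros q Hq; apply Hl; [exact Hq|apply agree_refl].
Qed.

Lemma eval_det (p : baire) (c : code) (a b b' : nat) :
  eval p c a b -> eval p c a b' -> b = b'.
Proof.
  intros H; revert b'.
  induction H as [a|a|a b|a b|a|f g a b c Hf IHf Hg IHg|f g a b c Hg IHg Hf IHf
    |f g a b Hf IHf|f g a n b c Hn IHn Hg IHg|f a n v Hv IHv Hn IHn]; intros b' E;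
    match type of E with eval _ _ ?x _ => remember x as arg eqn:Earg end;
    inversion E as [?|?|? ?|? ?|?|? ? ? b1 c1 Hf1 Hg1|? ? ? b1 ? Hg1 Hf1
      |? ? ? ? Hf1|? ? ? n1 b1 ? Hn1 Hg1|? ? ? v1 Hv1 Hn1]; subst;
    repeat match goal with
    | H : Cantor.to_nat _ = Cantor.to_nat _ |- _ =>
        apply Cantor.to_nat_inj, pair_equal_spec in H as [? ?]; subst
    | H : S _ = S _ |- _ => apply Nat.succ_inj in H; subst
    end; try congruence.
  - now rewrite (IHf b1), (IHg c1).
  - apply IHf; now rewrite (IHg b1).
  - now apply IHf.
  - apply IHg; now rewrite (IHn b1).
  - destruct (Nat.lt_trichotomy n b') as [Hlt|[Heq|Hlt]]; [|exact Heq|].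
    + discriminate (IHn _ (Hv1 n Hlt)).
    + discriminate (IHv b' Hlt _ Hn1).
Qed.

Lemma uniform_bound (P : nat -> nat -> Prop) (n : nat) :
  (forall m l l', l <= l' -> P m l -> P m l') ->
  (forall m, m < n -> exists l, P m l) -> exists l, forall m, m < n -> P m l.
Proof.
  intros Hmono; induction n as [|n IH]; intros HP; [exists 0; lia|].
  destruct IH as [l Hl]; [intros m Hm; apply HP; lia|].
  destruct (HP n) as [l' Hl']; [lia|].
  exists (max l l'); intros m Hm.
  destruct (Nat.eq_dec m n) as [->|Hne].
  - apply Hmono with l'; [lia|exact Hl'].
  - apply Hmono with l; [lia|apply Hl; lia].
Qed.

Lemma eval_use (c : code) (a b : nat) : baire_open (fun p => eval p c a b).
Proof.
  intros p H.
  induction H as [| | | |a|f g a b c _ [l Hl] _ [l' Hl']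
    |f g a b c _ [l Hl] _ [l' Hl']|f g a b _ [l Hl]
    |f g a n b c _ [l Hl] _ [l' Hl']|f a n v _ IHv _ [l' Hl']].
  1-4: exists 0; intros q _; constructor.
  - exists (S a); intros q Hq; rewrite (Hq a) by lia; constructor.
  - exists (max l l'); intros q Hq; constructor; [apply Hl|apply Hl'];
      (apply agree_le with (max l l'); [lia|exact Hq]).
  - exists (max l l'); intros q Hq; econstructor; [apply Hl|apply Hl'];
      (apply agree_le with (max l l'); [lia|exact Hq]).
  - exists l; intros q Hq; constructor; auto.
  - exists (max l l'); intros q Hq; econstructor; [apply Hl|apply Hl'];
      (apply agree_le with (max l l'); [lia|exact Hq]).
  - apply (uniform_bound
      (fun m l => forall q, agree l p q -> eval q f ⟨a, m⟩ (S (v m))) n) in IHv.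
    + destruct IHv as [l Hl]; exists (max l l'); intros q Hq.
      apply eval_mu with v; [intros m Hm; apply Hl; [exact Hm|]|apply Hl'];
        (apply agree_le with (max l l'); [lia|exact Hq]).
    + intros m k k' Hk Hm q Hq; apply Hm, agree_le with k'; assumption.
Qed.

Lemma interleave_agree (l : nat) (p p' r r' : baire) :
  agree l p p' -> agree l r r' -> agree l (interleave p r) (interleave p' r').
Proof.
  intros Hp Hr n Hn; unfold interleave.
  assert (Nat.div2 n <= n) by (apply Nat.div2_decr; lia).
  destruct (Nat.even n); [apply Hp|apply Hr]; lia.
Qed.

Lemma eval_continuous (c : code) : continuous (fun p => eval p c).
Proof.
  split; [intros p n b b'; apply eval_det|intros n b; apply eval_use].
Qed.

Lemma eval_interleave_continuous2 (c : code) :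
  continuous2 (fun p r => eval (interleave p r) c).
Proof.
  split; [intros p r n b b'; apply eval_det|].
  intros p r n b Hb; destruct (eval_use _ _ _ _ Hb) as [l Hl].
  exists l; intros p' r' Hp Hr; now apply Hl, interleave_agree.
Qed.

(** * Continuous reducibility *)

(** A problem on Baire space relates its instances to their solutions. *)
Definition problem : Type := baire -> baire -> Prop.

Definition solvable (F : problem) (p : baire) : Prop := exists q, F p q.

Definition reduces_via (A : functional) (B : baire -> functional) (F G : problem) :
    Prop :=
  continuous A /\ continuous2 B /\
  forall p, solvable F p -> exists k, maps A p k /\ solvable G k /\
    forall r, G k r -> exists s, maps (B p) r s /\ F p s.

Definition continuously_reduces (F G : problem) : Prop :=
  exists A B, reduces_via A B F G.

Lemma continuously_reduces_encode (F F' G : problem) (e : baire -> baire) :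
  (forall l u u', agree l u u' -> agree l (e u) (e u')) ->
  (forall u, solvable F' u -> solvable F (e u) /\ forall s, F (e u) s -> F' u s) ->
  continuously_reduces F G -> continuously_reduces F' G.
Proof.
  intros He HF (A & B & [Adet Aopen] & [Bdet Bloc] & Hred).
  exists (fun u => A (e u)), (fun u => B (e u)); split; [|split].
  - split; [intros u; apply Adet|].
    intros n b u Hb; destruct (Aopen _ _ _ Hb) as [l Hl].
    exists l; intros u' Hu; now apply Hl, He.
  - split; [intros u; apply Bdet|].
    intros u r n b Hb; destruct (Bloc _ _ _ _ Hb) as [l Hl].
    exists l; intros u' r' Hu Hr; apply Hl; [now apply He|exact Hr].
  - intros u Hu; destruct (HF u Hu) as [Hsolv Hsol].
    destruct (Hred _ Hsolv) as (k & HA & Hk & HB).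
    exists k; split; [exact HA|split; [exact Hk|]].
    intros r Hr; destruct (HB r Hr) as (s & Hs & HFs); exists s; auto.
Qed.

Lemma continuously_reduces_reindex (F G G' : problem) (h : nat -> nat) :
  (forall k, solvable G k -> solvable G' (fun n => k (h n)) /\
     forall r, G' (fun n => k (h n)) r -> G k r) ->
  continuously_reduces F G -> continuously_reduces F G'.
Proof.
  intros HG (A & B & [Adet Aopen] & HB & Hred).
  exists (fun p n => A p (h n)), B; split; [|split; [exact HB|]].
  - split; [intros p n; apply Adet|intros n; apply Aopen].
  - intros p Hp; destruct (Hred p Hp) as (k & HA & Hk & Hsol).
    destruct (HG k Hk) as [Hsolv HGk].
    exists (fun n => k (h n)); split; [intros n; apply HA|split; auto].
Qed.

Definition naming {X Y : repspace} (f : mvfun X Y) : problem :=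
  fun p q => exists x y, delta p x /\ f x y /\ delta q y.

Lemma naming_solvable {X Y : repspace} (f : mvfun X Y) (p : baire) (x : X) :
  delta p x -> solvable (naming f) p <-> dom f x.
Proof.
  intros Hp; split.
  - intros (q & x' & y & Hx & Hy & _).
    rewrite <- (graph_fun _ _ _ _ _ _ Hx Hp); now exists y.
  - intros [y Hy]; destruct (delta_surj _ y) as [q Hq]; exists q, x, y; auto.
Qed.

Lemma naming_at {X Y : repspace} (f : mvfun X Y) (p q : baire) (x : X) :
  delta p x -> naming f p q -> exists y, f x y /\ delta q y.
Proof.
  intros Hp (x' & y & Hx & Hy & Hq).
  rewrite (graph_fun _ _ _ _ _ _ Hx Hp) in Hy; now exists y.
Qed.

Definition selection (G : problem) (s : baire -> baire) : Prop :=
  forall k, solvable G k -> G k (s k).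

Lemma selection_exists (G : problem) : exists s, selection G s.
Proof.
  apply (choice (fun k q => solvable G k -> G k q)).
  intros k; destruct (classic (solvable G k)) as [[q Hq]|Hn].
  - now exists q.
  - now exists k.
Qed.

Lemma selection_through (G : problem) (k r : baire) :
  G k r -> exists s, selection G s /\ s k = r.
Proof.
  intros Hr; destruct (selection_exists G) as [s Hs].
  exists (fun k' => if excluded_middle_informative (k' = k) then r else s k').
  split; [intros k' Hk'|]; destruct excluded_middle_informative as [Heq|Hne].
  - now rewrite Heq.
  - now apply Hs.
  - reflexivity.
  - contradiction.
Qed.

Definition selection_pfun (G : problem) (s : baire -> baire) : pfun baire baire.
Proof.
  refine (Pfun (fun k q => q = s k /\ G k q) _).
  intros k q q' [-> _] [-> _]; reflexivity.
Defined.

Lemma selection_realizes {X Y : repspace} (f : mvfun X Y) (s : baire -> baire) :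
  selection (naming f) s -> realizes (selection_pfun (naming f) s) f.
Proof.
  intros Hs p x Hp Hx.
  assert (Hsp : naming f p (s p)) by (apply Hs, (naming_solvable f p x Hp), Hx).
  destruct (naming_at f p (s p) x Hp Hsp) as (y & Hy & Hq).
  exists (s p), y; repeat split; assumption.
Qed.

(** A realizer may be changed at a single point, so that every name of every
    solution of the inner instance has to be handled. *)
Lemma weihrauch_le_continuously_reduces {X Y Z W : repspace}
    (f : mvfun X Y) (g : mvfun Z W) :
  f ≤W g -> continuously_reduces (naming f) (naming g).
Proof.
  intros (H & K & [cH HH] & [cK HK] & Hred).
  exists (fun p => eval p cK), (fun p r => eval (interleave p r) cH).
  split; [apply eval_continuous|split; [apply eval_interleave_continuous2|]].
  intros p Hp; pose proof Hp as (_ & x & _ & Hx & _).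
  assert (Hrun : forall s, selection (naming g) s -> exists k t,
    K p k /\ naming g k (s k) /\ H (interleave p (s k)) t /\ naming f p t).
  { intros s Hs.
    destruct (Hred _ (selection_realizes g s Hs) p x Hx) as
      (t & y & (k & q & Hk & [-> Hq] & Ht) & Hty & Hy).
    - now apply (naming_solvable f p).
    - exists k, t; repeat split; [assumption..|]; now exists x, y. }
  destruct (selection_exists (naming g)) as [s0 Hs0].
  destruct (Hrun s0 Hs0) as (k & _ & Hk & Hgk & _).
  exists k; split; [exact (HK _ _ Hk)|split; [now exists (s0 k)|]].
  intros r Hr; destruct (selection_through _ k r Hr) as (s & Hs & Hsk).
  destruct (Hrun s Hs) as (k' & t & Hk' & _ & Ht & Hft).
  rewrite (graph_fun _ _ _ _ _ _ Hk' Hk), Hsk in Ht.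
  exists t; split; [exact (HH _ _ Ht)|exact Hft].
Qed.

(** * Finite prefixes *)

Definition starts_with (w : list nat) (u : baire) : Prop :=
  forall m, m < length w -> u m = nth m w 0.

Definition prefix (l : nat) (u : baire) : list nat := map u (seq 0 l).

Lemma starts_with_prefix (l : nat) (u u' : baire) :
  starts_with (prefix l u) u' <-> agree l u u'.
Proof.
  unfold starts_with, prefix; rewrite length_map, length_seq.
  assert (Hnth : forall m, m < l -> nth m (map u (seq 0 l)) 0 = u m).
  { intros m Hm; rewrite nth_indep with (d' := u 0)
      by now rewrite length_map, length_seq.
    now rewrite map_nth, seq_nth. }
  split; intros H m Hm; specialize (H m Hm); rewrite Hnth in * by exact Hm; auto.
Qed.

Definition then_const (w : list nat) (x : nat) : baire := fun m => nth m w x.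

Lemma then_const_starts_with (w : list nat) (x : nat) :
  starts_with w (then_const w x).
Proof. intros m Hm; now apply nth_indep. Qed.

Definition secured (B : baire -> functional) (w : list nat) : functional :=
  fun u j b =>
    exists l, forall u' r, agree l u u' -> starts_with w r -> B u' r j b.

Lemma secured_continuous (B : baire -> functional) (w : list nat) :
  continuous2 B -> continuous (secured B w).
Proof.
  intros [Bdet _]; split.
  - intros u j b b' [l Hl] [l' Hl'].
    pose proof (then_const_starts_with w 0) as Hw.
    exact (Bdet _ _ _ _ _ (Hl _ _ (agree_refl l u) Hw)
      (Hl' _ _ (agree_refl l' u) Hw)).
  - intros j b u [l Hl]; exists l; intros u' Hu; exists l; intros u'' r Hu'.
    now apply Hl, agree_trans with u'.
Qed.

Lemma secured_takes_value (B : baire -> functional) (w : list nat)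
    (P : nat -> nat -> Prop) (u r s : baire) :
  continuous2 B -> takes_value (secured B w) P u -> starts_with w r ->
  maps (B u) r s -> exists n, P n (s n).
Proof.
  intros [Bdet _] (n & b & HP & l & Hl) Hw Hs; exists n.
  now rewrite (Bdet _ _ _ _ _ (Hs n) (Hl u r (agree_refl l u) Hw)).
Qed.

Lemma value_secured (B : baire -> functional) (u r : baire) (j b : nat) :
  continuous2 B -> B u r j b -> exists w, starts_with w r /\ secured B w u j b.
Proof.
  intros [_ Bloc] Hb; destruct (Bloc _ _ _ _ Hb) as [l Hl].
  exists (prefix l r); split; [now apply starts_with_prefix|].
  exists l; intros u' r' Hu Hr; now apply Hl; [|apply starts_with_prefix].
Qed.

(** * Countable types *)

Definition countable (I : Type) : Prop :=
  exists e : I -> nat, forall i j, e i = e j -> i = j.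

Lemma countable_nat : countable nat.
Proof. now exists (fun n => n). Qed.

Lemma countable_prod (I J : Type) :
  countable I -> countable J -> countable (I * J).
Proof.
  intros [e He] [f Hf]; exists (fun x => ⟨e (fst x), f (snd x)⟩).
  intros [i j] [i' j'] H; simpl in H.
  apply Cantor.to_nat_inj, pair_equal_spec in H as [Hi Hj].
  now rewrite (He _ _ Hi), (Hf _ _ Hj).
Qed.

Lemma countable_list (I : Type) : countable I -> countable (list I).
Proof.
  intros [e He].
  exists (fix code is :=
    match is with nil => 0 | i :: is' => S ⟨e i, code is'⟩ end).
  intros is; induction is as [|i is IH]; intros [|j js]; try easy.
  intros H; apply Nat.succ_inj, Cantor.to_nat_inj, pair_equal_spec in H as [Hi His].
  now rewrite (He _ _ Hi), (IH _ His).
Qed.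

Lemma finite_initial_segment {I : Type} (e : I -> nat) (P : I -> Prop) (n : nat) :
  (forall i j, e i = e j -> i = j) ->
  exists is, forall i, In i is <-> P i /\ e i < n.
Proof.
  intros He; induction n as [|n [is IH]].
  - exists nil; simpl; intros i; lia.
  - destruct (classic (exists i, P i /\ e i = n)) as [(i & Hi & Hn)|Hno].
    + exists (i :: is); intros j; simpl; rewrite IH; split.
      * intros [<-|[Hj Hlt]]; (split; [assumption|lia]).
      * intros [Hj Hlt]; destruct (Nat.eq_dec (e j) n) as [Heq|Hne].
        -- left; apply He; congruence.
        -- right; split; [exact Hj|lia].
    + exists is; intros j; rewrite IH.
      assert (Hne : P j -> e j <> n) by (intros Hj Heq; apply Hno; now exists j).
      split; intros [Hj Hlt]; specialize (Hne Hj); (split; [exact Hj|lia]).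
Qed.

(** * Forcing *)

Record cond : Type := Cond {
  stem : list nat;
  allowed : nat -> Prop
}.

Definition extends (u : baire) (c : cond) : Prop :=
  starts_with (stem c) u /\ forall m, length (stem c) <= m -> allowed c (u m).

Definition stronger (c' c : cond) : Prop :=
  forall u, extends u c' -> extends u c.

Definition forces (c : cond) (U : baire -> Prop) : Prop :=
  forall u, extends u c -> U u.

Definition decides (c : cond) (U : baire -> Prop) : Prop :=
  forces c U \/ forces c (fun u => ~ U u).

Lemma stronger_refl (c : cond) : stronger c c.
Proof. now intros u. Qed.

Lemma stronger_trans (c1 c2 c3 : cond) :
  stronger c1 c2 -> stronger c2 c3 -> stronger c1 c3.
Proof. intros H12 H23 u Hu; auto. Qed.

Lemma then_const_extends (c : cond) (x : nat) :
  allowed c x -> extends (then_const (stem c) x) c.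
Proof.
  intros Hx; split; [apply then_const_starts_with|].
  intros m Hm; unfold then_const; now rewrite nth_overflow.
Qed.

Lemma stronger_allowed (c : cond) (S : nat -> Prop) :
  (forall i, S i -> allowed c i) -> stronger (Cond (stem c) S) c.
Proof. intros HS u [Hw Hu]; split; [exact Hw|simpl in *; auto]. Qed.

Definition lengthen (c : cond) (l : nat) (u : baire) : cond :=
  Cond (prefix (max (length (stem c)) l) u) (allowed c).

Lemma lengthen_extends (c : cond) (l : nat) (u : baire) :
  extends u c -> extends u (lengthen c l u).
Proof.
  intros [_ Hu]; split; [now apply starts_with_prefix|].
  intros m Hm; apply Hu; revert Hm; simpl; unfold prefix.
  rewrite length_map, length_seq; lia.
Qed.

Lemma extends_lengthen_agree (c : cond) (l : nat) (u u' : baire) :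
  extends u' (lengthen c l u) -> agree l u u'.
Proof.
  intros [Hw _]; apply (starts_with_prefix _ u) in Hw.
  apply agree_le with (2 := Hw); lia.
Qed.

Lemma lengthen_stronger (c : cond) (l : nat) (u : baire) :
  extends u c -> stronger (lengthen c l u) c.
Proof.
  intros [Hw Hu] u' [Hw' Hu']; apply (starts_with_prefix _ u) in Hw'.
  simpl in Hu'; unfold prefix in Hu'; rewrite length_map, length_seq in Hu'.
  split.
  - intros m Hm; rewrite <- Hw by exact Hm; symmetry; apply Hw'; lia.
  - intros m Hm; destruct (le_lt_dec (max (length (stem c)) l) m) as [Hl|Hl].
    + now apply Hu'.
    + rewrite <- Hw' by exact Hl; now apply Hu.
Qed.

Lemma force_open (c : cond) (u : baire) (U : baire -> Prop) :
  baire_open U -> extends u c -> U u ->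
  exists c', allowed c' = allowed c /\ stronger c' c /\ forces c' U /\ extends u c'.
Proof.
  intros HU Hu HUu; destruct (HU u HUu) as [l Hl].
  exists (lengthen c l u); split; [reflexivity|split; [|split]].
  - now apply lengthen_stronger.
  - intros u' Hu'; now apply Hl, (extends_lengthen_agree c).
  - now apply lengthen_extends.
Qed.

Lemma decide_open (c : cond) (U : baire -> Prop) :
  baire_open U ->
  exists c', allowed c' = allowed c /\ stronger c' c /\ decides c' U.
Proof.
  intros HU.
  destruct (classic (exists u, extends u c /\ U u)) as [(u & Hu & HUu)|Hn].
  - destruct (force_open c u U HU Hu HUu) as (c' & Ha & Hs & Hf & _).
    exists c'; split; [exact Ha|split; [exact Hs|now left]].
  - exists c; split; [reflexivity|split; [apply stronger_refl|right]].
    intros u Hu HUu; apply Hn; now exists u.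
Qed.

Lemma chain_limit (ch : nat -> cond) :
  (forall n, stronger (ch (S n)) (ch n)) ->
  (forall n, n <= length (stem (ch n))) ->
  (forall n, exists i, allowed (ch n) i) ->
  exists u, forall n, extends u (ch n).
Proof.
  intros Hstep Hlen Hinh.
  assert (Hmono : forall n m, n <= m -> stronger (ch m) (ch n)).
  { intros n m Hnm; induction Hnm as [|m _ IH]; [apply stronger_refl|].
    exact (stronger_trans _ _ _ (Hstep m) IH). }
  exists (fun m => nth m (stem (ch (S m))) 0).
  assert (Hlocal : forall n m, exists v, extends v (ch n) /\
    v m = nth m (stem (ch (S m))) 0).
  { intros n m; destruct (Hinh (max n (S m))) as [x Hx].
    apply then_const_extends in Hx; set (v := then_const _ x) in Hx.
    exists v; split; [apply (Hmono n (max n (S m))); [lia|exact Hx]|].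
    apply (Hmono (S m) (max n (S m))) in Hx as [Hw _]; [|lia].
    apply Hw, Hlen. }
  intros n; split; intros m Hm; destruct (Hlocal n m) as (v & [Hw Hv] & <-); auto.
Qed.

(** [K] restricts the sets of later entries of the conditions considered. *)
Definition dense_below (K : (nat -> Prop) -> Prop) (c0 : cond) (D : cond -> Prop) :
    Prop :=
  forall c, K (allowed c) -> stronger c c0 ->
  exists c', K (allowed c') /\ stronger c' c /\ D c'.

Lemma dense_below_injective {I : Type} (K : (nat -> Prop) -> Prop) (c0 : cond)
    (D : I -> cond -> Prop) (e : I -> nat) (n : nat) :
  (forall i j, e i = e j -> i = j) -> (forall i, dense_below K c0 (D i)) ->
  dense_below K c0 (fun c => forall i, e i = n -> D i c).
Proof.
  intros He HD c HKc Hc0; destruct (classic (exists i, e i = n)) as [[i Hi]|Hn].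
  - destruct (HD i c HKc Hc0) as (d & HKd & Hdc & Hd).
    exists d; split; [exact HKd|split; [exact Hdc|]].
    intros j Hj; rewrite (He j i); [exact Hd|congruence].
  - exists c; split; [exact HKc|split; [apply stronger_refl|]].
    intros i Hi; contradiction Hn; now exists i.
Qed.

Lemma dense_below_lengthen (K : (nat -> Prop) -> Prop) (c0 : cond)
    (D : cond -> Prop) (l : nat) :
  (forall S, K S -> exists i, S i) -> dense_below K c0 D ->
  dense_below K c0 (fun c => l <= length (stem c) /\
    exists d, K (allowed d) /\ stronger d c0 /\ stronger c d /\ D d).
Proof.
  intros Hinh HD c HKc Hc0; destruct (HD c HKc Hc0) as (d & HKd & Hdc & Hd).
  destruct (Hinh _ HKd) as [x Hx].
  apply then_const_extends, (lengthen_stronger d l) in Hx.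
  eexists; split; [|split; [exact (stronger_trans _ _ _ Hx Hdc)|split]].
  - exact HKd.
  - simpl; unfold prefix; rewrite length_map, length_seq; lia.
  - exists d; split; [exact HKd|split; [|now split]].
    exact (stronger_trans _ _ _ Hdc Hc0).
Qed.

Lemma generic_extension {I : Type} (K : (nat -> Prop) -> Prop) (c0 : cond)
    (D : I -> cond -> Prop) :
  countable I -> (forall S, K S -> exists i, S i) -> K (allowed c0) ->
  (forall i, dense_below K c0 (D i)) ->
  exists u, extends u c0 /\
    forall i, exists c, K (allowed c) /\ stronger c c0 /\ extends u c /\ D i c.
Proof.
  intros [e He] Hinh HK0 HD.
  pose (below := fun c => K (allowed c) /\ stronger c c0).
  assert (Hnext : forall nc : nat * cond, exists c', below (snd nc) ->
    below c' /\ stronger c' (snd nc) /\ S (fst nc) <= length (stem c') /\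
    exists d, below d /\ stronger c' d /\ forall i, e i = fst nc -> D i d).
  { intros [n c]; destruct (classic (below c)) as [[HKc Hc0]|Hn]; [|now exists c].
    destruct (dense_below_lengthen _ _ _ (S n) Hinh
      (dense_below_injective K c0 D e n He HD) c HKc Hc0)
      as (c' & HKc' & Hc'c & Hlen & d & HKd & Hd0 & Hc'd & Hd).
    exists c'; intros _; split; [split|split; [|split]]; auto.
    - exact (stronger_trans _ _ _ Hc'c Hc0).
    - exists d; split; [now split|now split]. }
  apply choice in Hnext as [next Hnext].
  pose (ch := nat_rect (fun _ => cond) c0 (fun n c => next (n, c))).
  assert (Hbelow : forall n, below (ch n)).
  { intros n; induction n as [|n IH]; [split; [exact HK0|apply stronger_refl]|].
    apply (Hnext (n, ch n) IH). }
  destruct (chain_limit ch) as [u Hu].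
  - intros n; apply (Hnext (n, ch n)), Hbelow.
  - intros [|n]; [lia|]; apply (Hnext (n, ch n)), Hbelow.
  - intros n; apply Hinh, Hbelow.
  - exists u; split; [apply (Hu 0)|intros i].
    destruct (Hnext (e i, ch (e i)) (Hbelow _))
      as (_ & _ & _ & d & [HK Hd0] & Hd & HDd).
    exists d; split; [exact HK|split; [exact Hd0|split; [|auto]]].
    apply Hd, (Hu (S (e i))).
Qed.

(** * Cluster points *)

Lemma neighbourhood_iff (D : R -> Prop) (y : R) :
  neighbourhood D y <->
  exists eps, (0 < eps)%R /\ forall z, (Rabs (z - y) < eps)%R -> D z.
Proof.
  split.
  - intros [[eps Heps] HD]; now exists eps.
  - intros (eps & Heps & HD); now exists (mkposreal eps Heps).
Qed.

Lemma neighbourhood_forall_lt (D : nat -> R -> Prop) (n : nat) (y : R) :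
  (forall m, m < n -> neighbourhood (D m) y) ->
  neighbourhood (fun z => forall m, m < n -> D m z) y.
Proof.
  setoid_rewrite neighbourhood_iff.
  induction n as [|n IH]; intros H; [exists 1%R; split; [lra|lia]|].
  destruct IH as (eps & Heps & Hlt); [intros m Hm; apply H; lia|].
  destruct (H n) as (eps' & Heps' & Hn); [lia|].
  exists (Rmin eps eps'); split; [now apply Rmin_pos|].
  intros z Hz m Hm; apply Rmin_Rgt in Hz as [Hz Hz'].
  destruct (Nat.eq_dec m n) as [->|Hne]; [now apply Hn|apply Hlt; [exact Hz|lia]].
Qed.

Lemma closed_set_Exists {I : Type} (D : I -> R -> Prop) (is : list I) :
  (forall i, closed_set (D i)) -> closed_set (fun y => Exists (fun i => D i y) is).
Proof.
  intros HD; induction is as [|i is IH]; unfold closed_set.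
  - apply open_set_P6 with (1 := open_set_P5).
    split; intros z; unfold complementary; now rewrite Exists_nil.
  - apply open_set_P6 with (1 := open_set_P3 _ _ (HD i) IH).
    unfold complementary, intersection_domain.
    split; intros z; rewrite Exists_cons; tauto.
Qed.

Lemma ValAdh_iff (x : nat -> R) (y : R) :
  ValAdh x y <->
  forall eps, (0 < eps)%R -> forall N, exists n, N <= n /\ (Rabs (x n - y) < eps)%R.
Proof.
  split.
  - intros H eps Heps N; apply (H (disc y (mkposreal eps Heps)) N).
    now exists (mkposreal eps Heps).
  - intros H D N HD; apply neighbourhood_iff in HD as (eps & Heps & HD).
    destruct (H eps Heps N) as (n & Hn & Hx); exists n; auto.
Qed.

Lemma ValAdh_subseq (x : nat -> R) (i : nat -> nat) (y : R) :
  (forall n, n <= i n) -> ValAdh (fun n => x (i n)) y -> ValAdh x y.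
Proof.
  intros Hi H D N HD; destruct (H D N HD) as (n & Hn & Hx).
  exists (i n); split; [specialize (Hi n); lia|exact Hx].
Qed.

Lemma ValAdh_closed_set (D : R -> Prop) (x : nat -> R) (y : R) (N : nat) :
  closed_set D -> (forall n, N <= n -> D (x n)) -> ValAdh x y -> D y.
Proof.
  intros HD Hx Hy; apply NNPP; intros Hn.
  destruct (Hy (complementary D) N (HD y Hn)) as (n & HNn & Hc).
  exact (Hc (Hx n HNn)).
Qed.

Lemma bounded_seq_eventually (x : nat -> R) (M : R) (N : nat) :
  (forall n, N <= n -> (Rabs (x n) <= M)%R) -> bounded_seq x.
Proof.
  revert M; induction N as [|N IH]; intros M HM.
  - exists M; intros n; apply HM; lia.
  - apply (IH (Rmax M (Rabs (x N)))); intros n Hn.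
    destruct (Nat.eq_dec n N) as [->|Hne]; [apply Rmax_r|].
    apply Rle_trans with (2 := Rmax_l _ _), HM; lia.
Qed.

Lemma bounded_seq_ValAdh (x : nat -> R) : bounded_seq x -> exists y, ValAdh x y.
Proof. intros Hx; apply dom_BWT_R in Hx as (y & _ & Hy); now exists y. Qed.

(** Compactness of the set of cluster points: otherwise a subsequence avoids
    more and more of the sets, and so all of them near its cluster point. *)
Lemma bounded_seq_finite_cover {I : Type} (P : I -> Prop) (D : I -> R -> Prop)
    (x : nat -> R) :
  countable I -> bounded_seq x ->
  (forall y, ValAdh x y -> exists i, P i /\ neighbourhood (D i) y) ->
  exists is N, Forall P is /\ forall n, N <= n -> Exists (fun i => D i (x n)) is.
Proof.
  intros [e He] [M HM] HD; apply NNPP; intros Hno.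
  assert (Hescape : forall n, exists m, n <= m /\
    forall i, P i -> e i < n -> ~ D i (x m)).
  { intros n; apply NNPP; intros Hn.
    destruct (finite_initial_segment e P n He) as [is His].
    apply Hno; exists is, n; split.
    { apply Forall_forall; intros i Hi; now apply His. }
    intros m Hm; apply NNPP; intros HE; apply Hn; exists m; split; [exact Hm|].
    intros i Hi Hlt HDi; apply HE, Exists_exists; exists i; now rewrite His. }
  apply choice in Hescape as [m Hm].
  destruct (bounded_seq_ValAdh (fun n => x (m n))) as [y Hy]; [now exists M|].
  destruct (HD y) as (i & Hi & HDi);
    [apply ValAdh_subseq with m; [apply Hm|exact Hy]|].
  destruct (Hy (D i) (S (e i)) HDi) as (n & Hn & HDn).
  exact (proj2 (Hm n) i Hi Hn HDn).
Qed.

Lemma UCL_R_eventually_near (x : nat -> R) (y M : R) (D : R -> Prop) :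
  UCL_R x y -> neighbourhood D y ->
  exists N, forall n, N <= n -> (Rabs (x n) <= M)%R -> D (x n).
Proof.
  intros [_ Huniq] HD; apply NNPP; intros Hno.
  assert (Hout : forall m, exists n, m <= n /\ (Rabs (x n) <= M)%R /\ ~ D (x n)).
  { intros m; apply NNPP; intros Hm; apply Hno; exists m; intros n Hn HM.
    apply NNPP; intros HDn; apply Hm; now exists n. }
  apply choice in Hout as [i Hi].
  destruct (bounded_seq_ValAdh (fun m => x (i m))) as [z Hz].
  { exists M; intros m; apply Hi. }
  assert (Heq : z = y) by (apply Huniq, ValAdh_subseq with i; [apply Hi|exact Hz]).
  rewrite Heq in Hz; destruct (Hz D 0 HD) as (m & _ & HDm).
  exact (proj2 (proj2 (Hi m)) HDm).
Qed.

Lemma INR_close (m n : nat) : (Rabs (INR m - INR n) < 1)%R -> m = n.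
Proof.
  intros H; destruct (Nat.lt_trichotomy m n) as [Hlt|[Heq|Hlt]]; [|exact Heq|];
    apply le_INR in Hlt; rewrite S_INR in Hlt; split_Rabs; lra.
Qed.

Lemma ValAdh_INR (u : nat -> nat) (z : R) :
  ValAdh (fun m => INR (u m)) z <-> exists n, z = INR n /\ CL_N u n.
Proof.
  rewrite ValAdh_iff; split.
  - intros H; destruct (H (/ 2)%R ltac:(lra) 0) as (m0 & _ & Hm0).
    assert (Hnear : forall eps, (0 < eps)%R -> forall N, exists m, N <= m /\
      u m = u m0 /\ (Rabs (INR (u m0) - z) < eps)%R).
    { intros eps Heps N.
      destruct (H (Rmin (/ 2) eps) ltac:(apply Rmin_pos; lra) N) as (m & Hm & Hmz).
      apply Rmin_Rgt in Hmz as [Hhalf Hmz].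
      assert (Heq : u m = u m0) by (apply INR_close; split_Rabs; lra).
      rewrite Heq in Hmz; now exists m. }
    exists (u m0); split.
    + symmetry; apply cond_eq; intros eps Heps.
      now destruct (Hnear eps Heps 0) as (_ & _ & _ & Hz).
    + intros N; destruct (Hnear 1%R Rlt_0_1 N) as (m & Hm & Heq & _); now exists m.
  - intros (n & -> & Hn) eps Heps N; destruct (Hn N) as (m & Hm & Heq).
    exists m; split; [exact Hm|]; now rewrite Heq, Rminus_diag, Rabs_R0.
Qed.

(** * Names of reals and their prefixes *)

Lemma inv_pow2_pos (m : nat) : (0 < / 2 ^ m)%R.
Proof. apply Rinv_0_lt_compat, pow_lt; lra. Qed.

Lemma Un_cv_inv_pow2 (x : nat -> R) (y : R) :
  (forall m, Rabs (x m - y) <= / 2 ^ m)%R -> Un_cv x y.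
Proof.
  intros Hx eps Heps; destruct (cv_pow_half 1 eps Heps) as [N HN].
  exists N; intros m Hm; specialize (HN m Hm); specialize (Hx m).
  unfold Rdist, Rdiv in HN; pose proof (inv_pow2_pos m).
  rewrite Rminus_0_r, Rmult_1_l, Rabs_pos_eq in HN by lra; unfold Rdist; lra.
Qed.

Lemma inv_pow2_small (eps : R) : (0 < eps)%R -> exists m, (/ 2 ^ m < eps)%R.
Proof.
  intros Heps; destruct (Un_cv_inv_pow2 (fun m => / 2 ^ m)%R 0) with eps as [N HN].
  - intros m; pose proof (inv_pow2_pos m); split_Rabs; lra.
  - exact Heps.
  - exists N; specialize (HN N (le_n N)); unfold Rdist in HN; split_Rabs; lra.
Qed.

Lemma real_delta_error (r : baire) (y : R) (m : nat) :
  real_delta r y -> (Rabs (ratR (r m) - y) <= / 2 ^ m)%R.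
Proof.
  intros [Hcauchy Hlim]; apply le_epsilon; intros eps Heps.
  destruct (Hlim eps Heps) as [N HN]; specialize (HN (S (max N m)) ltac:(lia)).
  specialize (Hcauchy m (S (max N m)) ltac:(lia)).
  unfold Rdist in HN; split_Rabs; lra.
Qed.

Lemma real_delta_of_error (r : baire) (y : R) :
  (forall m, Rabs (ratR (r m) - y) <= / 2 ^ m / 2)%R -> real_delta r y.
Proof.
  intros Hr; split.
  - intros m k Hmk.
    assert (Hlt : (/ 2 ^ k < / 2 ^ m)%R).
    { apply Rinv_lt_contravar; [apply Rmult_lt_0_compat; apply pow_lt; lra|].
      apply Rlt_pow; [lra|exact Hmk]. }
    pose proof (Hr m); pose proof (Hr k); split_Rabs; lra.
  - apply Un_cv_inv_pow2; intros m; specialize (Hr m).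
    pose proof (inv_pow2_pos m); lra.
Qed.

Lemma real_delta_const (i : nat) : real_delta (fun _ => i) (ratR i).
Proof.
  apply real_delta_of_error; intros m.
  rewrite Rminus_diag, Rabs_R0; pose proof (inv_pow2_pos m); lra.
Qed.

(** Half of the error permitted in a name, so that [w] can always be continued to
    a name of [y]. *)
Definition nbhd (w : list nat) (y : R) : Prop :=
  forall m, m < length w -> (Rabs (y - ratR (nth m w 0%nat)) <= / 2 ^ m / 2)%R.

Lemma nbhd_closed_set (w : list nat) : closed_set (nbhd w).
Proof.
  intros y Hy; apply not_all_ex_not in Hy as [m Hm].
  apply imply_to_and in Hm as [Hm Hlt]; apply Rnot_le_lt in Hlt.
  apply neighbourhood_iff; eexists; split; [apply Rlt_0_minus; exact Hlt|].
  intros z Hz Hn; specialize (Hn m Hm); split_Rabs; lra.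
Qed.

Lemma nbhd_name (w : list nat) (y : R) :
  nbhd w y -> exists r, real_delta r y /\ starts_with w r.
Proof.
  intros Hw.
  assert (Hr : forall m, exists i, (m < length w -> i = nth m w 0) /\
    (Rabs (ratR i - y) <= / 2 ^ m / 2)%R).
  { intros m; destruct (le_lt_dec (length w) m) as [Hge|Hlt].
    - destruct (ratR_dense y (/ 2 ^ m / 2)) as [i Hi];
        [pose proof (inv_pow2_pos m); lra|].
      exists i; split; [lia|lra].
    - exists (nth m w 0); split; [reflexivity|].
      rewrite Rabs_minus_sym; now apply Hw. }
  apply choice in Hr as [r Hr]; exists r; split.
  - apply real_delta_of_error; apply Hr.
  - intros m; apply Hr.
Qed.

(** Strict bounds leave room to move the named real. *)
Lemma interior_name (y : R) :
  exists r, real_delta r y /\ forall w, starts_with w r -> neighbourhood (nbhd w) y.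
Proof.
  assert (Hr : forall m, exists i, (Rabs (ratR i - y) < / 2 ^ m / 2)%R)
    by (intros m; apply ratR_dense; pose proof (inv_pow2_pos m); lra).
  apply choice in Hr as [r Hr]; exists r; split.
  - apply real_delta_of_error; intros m; left; apply Hr.
  - intros w Hw; apply neighbourhood_forall_lt; intros m Hm.
    rewrite <- Hw by exact Hm; specialize (Hr m).
    apply neighbourhood_iff; exists (/ 2 ^ m / 2 - Rabs (ratR (r m) - y))%R.
    split; [lra|intros z Hz; split_Rabs; lra].
Qed.

(** * Sequences of rationals *)

Definition rational_seq (u : baire) : nat -> R := fun i => ratR (u i).

Definition limit_problem : Type := mvfun (seq_space real_space) real_space.

Definition on_rationals (f : limit_problem) : problem :=
  fun u r => exists y, f (rational_seq u) y /\ real_delta r y.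

Lemma on_rationals_solvable (f : limit_problem) (u : baire) :
  solvable (on_rationals f) u <-> dom f (rational_seq u).
Proof.
  split.
  - intros (r & y & Hy & _); now exists y.
  - intros [y Hy]; destruct (real_delta_surj y) as [r Hr]; now exists r, y.
Qed.

Definition visits (A : functional) (V : R -> Prop) (m : nat) : baire -> Prop :=
  takes_value A (fun i b => m <= i /\ V (ratR b)).

(** * Cluster points do not find the recurrent number *)

Definition UCL_N : mvfun (seq_space nat_space) nat_space :=
  fun (u : nat -> nat) (c : nat) => CL_N u c /\ forall d, CL_N u d -> d = c.

Lemma UCL_N_then_const (w : list nat) (c : nat) : UCL_N (then_const w c) c.
Proof.
  assert (Htail : forall m, length w <= m -> then_const w c m = c)
    by (intros m Hm; now apply nth_overflow).
  split.
  - intros N; exists (max N (length w)); split; [lia|apply Htail; lia].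
  - intros d Hd; destruct (Hd (length w)) as (m & Hm & <-); now apply Htail.
Qed.

(** The answer is read off from entry [j] of the solution by means of [decode]. *)
Definition recurrent_number (j : nat) (decode : nat -> nat) : problem :=
  fun u s => UCL_N u (decode (s j)).

Lemma recurrent_number_solvable (j : nat) (decode : nat -> nat) (u : baire)
    (c : nat) :
  (forall n, exists b, decode b = n) -> UCL_N u c ->
  solvable (recurrent_number j decode) u.
Proof. intros Hd Hc; destruct (Hd c) as [b <-]; now exists (fun _ => b). Qed.

Definition covered (ws : list (list nat)) (y : R) : Prop :=
  Exists (fun w => nbhd w y) ws.

Definition zero_or_above (t i : nat) : Prop := i = 0 \/ t < i.

Definition zero_confined (S : nat -> Prop) : Prop := exists t, S = zero_or_above t.

Lemma dense_below_zero_confined (U : baire -> Prop) (m : nat) (c0 : cond) :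
  baire_open U ->
  dense_below zero_confined c0 (fun c => decides c U /\
    forces c (fun u => exists s, m <= s /\ u s = 0) /\
    forall i, allowed c i -> zero_or_above m i).
Proof.
  intros HU c [t Ht] _.
  destruct (decide_open c U HU) as (c1 & Ha1 & Hs1 & Hdec).
  destruct (force_open c1 (then_const (stem c1) 0)
    (fun u => exists s, m <= s /\ u s = 0)) as (c2 & Ha2 & Hs2 & Hzero & _).
  - intros u (s & Hs & Hus); exists (S s); intros u' Hu; exists s.
    rewrite <- Hu by lia; now split.
  - apply then_const_extends; rewrite Ha1, Ht; now left.
  - exists (max m (length (stem c1))); split; [lia|apply nth_overflow; lia].
  - pose (c3 := Cond (stem c2) (zero_or_above (max t m))).
    assert (Hs3 : stronger c3 c2).
    { apply stronger_allowed; rewrite Ha2, Ha1, Ht; unfold zero_or_above; lia. }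
    exists c3; split; [now exists (max t m)|split; [|split; [|split]]].
    + exact (stronger_trans _ _ _ Hs3 (stronger_trans _ _ _ Hs2 Hs1)).
    + destruct Hdec as [H|H]; [left|right]; intros u Hu; apply H, Hs2, Hs3, Hu.
    + intros u Hu; apply Hzero, Hs3, Hu.
    + simpl; unfold zero_or_above; lia.
Qed.

Lemma recurrent_zero_generic {I : Type} (i0 : I) (U : I -> baire -> Prop) :
  countable I -> (forall i, baire_open (U i)) ->
  exists u, UCL_N u 0 /\ forall i, exists c,
    zero_confined (allowed c) /\ extends u c /\ decides c (U i).
Proof.
  intros HI HU.
  destruct (generic_extension zero_confined (Cond nil (zero_or_above 0))
    (fun im c => decides c (U (fst im)) /\
       forces c (fun u => exists s, snd im <= s /\ u s = 0) /\
       forall i, allowed c i -> zero_or_above (snd im) i))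
    as (u & _ & Hu).
  - exact (countable_prod _ _ HI countable_nat).
  - intros S [t ->]; exists 0; now left.
  - now exists 0.
  - intros [i m]; now apply dense_below_zero_confined.
  - exists u; split; [split|].
    + intros N; destruct (Hu (i0, N)) as (c & _ & _ & Hc & _ & Hzero & _).
      exact (Hzero u Hc).
    + intros n Hn; destruct (Hu (i0, n)) as (c & _ & _ & [_ Hc] & _ & _ & Habove).
      destruct (Hn (length (stem c))) as (m & Hm & Hum).
      specialize (Habove _ (Hc m Hm)); rewrite Hum in Habove.
      destruct Habove; [assumption|simpl in *; lia].
    + intros i; destruct (Hu (i, 0)) as (c & HK & _ & Hc & Hdec & _).
      now exists c.
Qed.

Section RecurrentNumber.

Variables (j : nat) (decode : nat -> nat).
Variables (A : functional) (B : baire -> functional).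
Hypothesis decode_surj : forall n, exists b, decode b = n.
Hypothesis reduction :
  reduces_via A B (recurrent_number j decode) (on_rationals BWT_R).

Definition secured_answer (w : list nat) (n : nat) (u : baire) : Prop :=
  takes_value (secured B w) (fun i b => i = j /\ decode b = n) u.

Lemma secured_answer_open (w : list nat) (n : nat) :
  baire_open (secured_answer w n).
Proof.
  destruct reduction as (_ & HB & _).
  now apply takes_value_open, secured_continuous.
Qed.

Lemma finitely_many_prefixes_secure (u : baire) (n : nat) :
  UCL_N u n -> exists ws m, Forall (fun w => secured_answer w n u) ws /\
    ~ visits A (fun z => ~ covered ws z) m u.
Proof.
  destruct reduction as (HA & HB & Hred); intros Hn.
  destruct (Hred u (recurrent_number_solvable j decode u n decode_surj Hn))
    as (k & HAk & Hk & Hsol).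
  apply on_rationals_solvable in Hk as [_ [Hbd _]].
  destruct (bounded_seq_finite_cover (fun w => secured_answer w n u) nbhd
    (rational_seq k)) as (ws & m & Hws & Hcov).
  - exact (countable_list _ countable_nat).
  - exact Hbd.
  - intros y Hy; destruct (interior_name y) as (r & Hr & Hint).
    destruct (Hsol r) as (s & Hs & Hus); [now exists y|].
    destruct (value_secured B u r j (s j) HB (Hs j)) as (w & Hw & Hsec).
    exists w; split; [exists j, (s j)|exact (Hint w Hw)].
    split; [split; [reflexivity|now apply Hn, Hus]|exact Hsec].
  - exists ws, m; split; [exact Hws|].
    intros Hout; apply (takes_value_maps A _ u k HA HAk) in Hout as (i & Hi & Hnc).
    exact (Hnc (Hcov i Hi)).
Qed.

Lemma secured_answer_correct (u : baire) (n n' m : nat) (ws : list (list nat)) :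
  UCL_N u n -> Forall (fun w => secured_answer w n' u) ws ->
  ~ visits A (fun z => ~ covered ws z) m u -> n' = n.
Proof.
  destruct reduction as (HA & HB & Hred); intros Hn Hws Hm.
  destruct (Hred u (recurrent_number_solvable j decode u n decode_surj Hn))
    as (k & HAk & Hk & Hsol).
  apply on_rationals_solvable in Hk as [y [Hbd Hy]].
  assert (Hcov : covered ws y).
  { apply (ValAdh_closed_set _ (rational_seq k) y m); [|intros i Hi|exact Hy].
    - apply closed_set_Exists, nbhd_closed_set.
    - apply NNPP; intros Hnc; apply Hm, (takes_value_maps A _ u k HA HAk).
      now exists i. }
  apply Exists_exists in Hcov as (w & Hin & Hw).
  destruct (nbhd_name w y Hw) as (r & Hr & Hwr).
  destruct (Hsol r) as (s & Hs & Hus); [now exists y|].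
  destruct (secured_takes_value B w _ u r s HB
    (proj1 (Forall_forall _ _) Hws w Hin) Hwr Hs) as (i & -> & <-).
  apply Hn, Hus.
Qed.

End RecurrentNumber.

Lemma recurrent_number_not_reducible_to_BWT_R (j : nat) (decode : nat -> nat) :
  (forall n, exists b, decode b = n) ->
  ~ continuously_reduces (recurrent_number j decode) (on_rationals BWT_R).
Proof.
  intros Hdecode (A & B & Hred); pose proof Hred as (HA & _).
  destruct (recurrent_zero_generic (nil, 0)
    (fun wm => visits A (fun z => ~ covered (fst wm) z) (snd wm)))
    as (u & Hu0 & Hdec).
  { repeat (apply countable_prod || apply countable_list || apply countable_nat). }
  { intros wm; now apply takes_value_open. }
  destruct (finitely_many_prefixes_secure j decode A B Hdecode Hred u 0 Hu0)
    as (ws & m & Hws & Hm).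
  destruct (Hdec (ws, m)) as (c & [t Ht] & Hc & [Hvis|Hnvis]);
    [exact (Hm (Hvis u Hc))|].
  destruct (force_open c u
    (fun u => Forall (fun w => secured_answer j decode B w 0 u) ws))
    as (c' & Ha & Hs & Hforce & _); [|exact Hc|exact Hws|].
  { apply baire_open_Forall; intros w; now apply secured_answer_open with A. }
  assert (Hq : extends (then_const (stem c') (S t)) c').
  { apply then_const_extends; rewrite Ha, Ht; right; lia. }
  discriminate (secured_answer_correct j decode A B Hdecode Hred _ (S t) 0 m ws
    (UCL_N_then_const _ _) (Hforce _ Hq) (Hnvis _ (Hs _ Hq))).
Qed.

(** * Cluster points are not countably determined *)

Definition in_range (a b : R) (i : nat) : Prop := (a <= ratR i <= b)%R.

Definition is_interval (S : nat -> Prop) : Prop :=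
  exists a b, (a < b)%R /\ S = in_range a b.

Lemma is_interval_in_range (a b : R) : (a < b)%R -> is_interval (in_range a b).
Proof. intros Hab; now exists a, b. Qed.

Lemma is_interval_inhabited (S : nat -> Prop) : is_interval S -> exists i, S i.
Proof.
  intros (a & b & Hab & ->).
  destruct (ratR_dense ((a + b) / 2) ((b - a) / 2)) as [i Hi]; [lra|].
  exists i; unfold in_range; split_Rabs; lra.
Qed.

Lemma extends_bounded_seq (c : cond) (u : baire) :
  is_interval (allowed c) -> extends u c -> bounded_seq (rational_seq u).
Proof.
  intros (a & b & _ & Ha) [_ Hu].
  apply bounded_seq_eventually with (Rabs a + Rabs b)%R (length (stem c)).
  intros n Hn; specialize (Hu n Hn); rewrite Ha in Hu; destruct Hu.
  unfold rational_seq; split_Rabs; lra.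
Qed.

Lemma extends_solvable (c : cond) (u : baire) :
  is_interval (allowed c) -> extends u c -> solvable (on_rationals BWT_R) u.
Proof.
  intros HK Hu.
  apply on_rationals_solvable, dom_BWT_R; exact (extends_bounded_seq c u HK Hu).
Qed.

(** [/ 2 ^ j] bounds the error of entry [j] of a name. *)
Definition separated (lo hi : R) (j b : nat) : Prop :=
  (ratR b + / 2 ^ j < lo \/ hi < ratR b - / 2 ^ j)%R.

Lemma real_delta_separated (s : baire) (v a b : R) :
  real_delta s v -> (a < b)%R ->
  exists lo hi j, (a <= lo < hi /\ hi <= b)%R /\ separated lo hi j (s j).
Proof.
  intros Hs Hab; destruct (inv_pow2_small ((b - a) / 8)) as [j Hj]; [lra|].
  pose proof (real_delta_error s v j Hs) as Herr; unfold separated.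
  destruct (Rle_lt_dec ((a + b) / 2) v) as [Hv|Hv].
  - exists a, ((3 * a + b) / 4)%R, j; split; [lra|right; split_Rabs; lra].
  - exists ((a + 3 * b) / 4)%R, b, j; split; [lra|left; split_Rabs; lra].
Qed.

Lemma cluster_name_not_separated (c : cond) (u s : baire) (lo hi : R) (j : nat) :
  allowed c = in_range lo hi -> extends u c -> on_rationals BWT_R u s ->
  ~ separated lo hi j (s j).
Proof.
  intros Ha [_ Hu] (v & [_ Hadh] & Hs) Hsep.
  assert (Hv : (lo <= v <= hi)%R).
  { apply (ValAdh_closed_set (fun z => lo <= z <= hi)%R (rational_seq u) v
      (length (stem c))); [apply compact_P2, compact_P3| |exact Hadh].
    intros n Hn; specialize (Hu n Hn); now rewrite Ha in Hu. }
  pose proof (real_delta_error s v j Hs); destruct Hsep; split_Rabs; lra.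
Qed.

Definition excludes (A : functional) (lo hi : R) : baire -> Prop :=
  takes_value A (separated lo hi).

Lemma narrow_excluding (A : functional) (c : cond) (a b lo hi : R) (u : baire) :
  continuous A -> allowed c = in_range a b -> (a <= lo /\ hi <= b)%R ->
  extends u c -> excludes A lo hi u ->
  exists c', allowed c' = in_range lo hi /\ stronger c' c /\
    forces c' (excludes A lo hi).
Proof.
  intros HA Ha Hle Hu Hex.
  destruct (force_open c u (excludes A lo hi)) as (c1 & Ha1 & Hs1 & Hf1 & _);
    [now apply takes_value_open|exact Hu|exact Hex|].
  exists (Cond (stem c1) (in_range lo hi)).
  assert (Hs2 : stronger (Cond (stem c1) (in_range lo hi)) c1).
  { apply stronger_allowed; rewrite Ha1, Ha; unfold in_range; intros i Hi; lra. }
  split; [reflexivity|split; [exact (stronger_trans _ _ _ Hs2 Hs1)|]].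
  intros v Hv; apply Hf1, Hs2, Hv.
Qed.

Lemma dense_below_wrong_answer (A : functional) (c0 : cond) :
  continuous A ->
  dense_below is_interval c0 (fun c => forces c (fun u =>
    forall s, maps A u s -> ~ on_rationals BWT_R u s)).
Proof.
  intros HA c (a & b & Hab & Ha) _.
  destruct (classic (exists u s,
    extends u c /\ maps A u s /\ on_rationals BWT_R u s))
    as [(u & s & Hu & HAs & v & _ & Hs)|Hno].
  - destruct (real_delta_separated s v a b Hs Hab) as (lo & hi & j & Hle & Hsep).
    destruct (narrow_excluding A c a b lo hi u HA Ha)
      as (c' & Ha' & Hs' & Hf); [lra|exact Hu|now exists j, (s j)|].
    exists c'; rewrite Ha'; split; [apply is_interval_in_range; lra|].
    split; [exact Hs'|intros u' Hu' s' HAs' Hsol].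
    destruct (proj1 (takes_value_maps A _ u' s' HA HAs') (Hf u' Hu')) as [i Hsep'].
    exact (cluster_name_not_separated c' u' s' lo hi i Ha' Hu' Hsol Hsep').
  - exists c; split; [now exists a, b|split; [apply stronger_refl|]].
    intros u Hu s HAs Hsol; apply Hno; now exists u, s.
Qed.

Lemma BWT_R_not_reducible_to_countably_many_answers
    (G : problem) (answer : nat -> baire) :
  (forall k, solvable G k -> exists n, G k (answer n)) ->
  ~ continuously_reduces (on_rationals BWT_R) G.
Proof.
  intros HG (A & B & _ & HB & Hred).
  pose (c0 := Cond nil (in_range 0 1)).
  assert (HK : is_interval (allowed c0)) by (apply is_interval_in_range; lra).
  destruct (generic_extension is_interval c0 (fun n c => forces c (fun u =>
    forall s, maps (fun p => B p (answer n)) u s -> ~ on_rationals BWT_R u s)))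
    as (u & Hu & Hgen).
  - exact countable_nat.
  - exact is_interval_inhabited.
  - exact HK.
  - intros n; now apply dense_below_wrong_answer, continuous2_section.
  - destruct (Hred u (extends_solvable c0 u HK Hu)) as (k & _ & Hk & Hsol).
    destruct (HG k Hk) as [n Hn]; destruct (Hsol _ Hn) as (s & Hs & Hus).
    destruct (Hgen n) as (c & _ & _ & Hc & Hforce); exact (Hforce u Hc s Hs Hus).
Qed.

(** * Cluster points do not reduce to unique cluster points *)

Definition ball (M z : R) : Prop := (Rabs z <= M)%R.

Definition ball_outside (M : R) (w : list nat) (z : R) : Prop :=
  ball M z /\ ~ nbhd w z.

Section UniqueCluster.

Variables (A : functional) (B : baire -> functional).
Hypothesis reduction : reduces_via A B (on_rationals BWT_R) (on_rationals UCL_R).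

Lemma inner_solution (c : cond) (u : baire) :
  is_interval (allowed c) -> extends u c ->
  exists k y, maps A u k /\ UCL_R (rational_seq k) y /\
    forall r, real_delta r y -> exists s, maps (B u) r s /\ on_rationals BWT_R u s.
Proof.
  destruct reduction as (_ & _ & Hred); intros HK Hu.
  destruct (Hred u (extends_solvable c u HK Hu)) as (k & HAk & Hk & Hsol).
  apply on_rationals_solvable in Hk as [y Hy]; exists k, y.
  split; [exact HAk|split; [exact Hy|intros r Hr]].
  apply Hsol; now exists y.
Qed.

Section ForcedReturns.

Variables (M : R) (c0 : cond).
Hypothesis returns : forall c m, is_interval (allowed c) -> stronger c c0 ->
  exists u, extends u c /\ visits A (ball M) m u.

Lemma returning_extension (c : cond) :
  is_interval (allowed c) -> stronger c c0 ->
  exists u, extends u c /\ forall m, visits A (ball M) m u.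
Proof.
  destruct reduction as (HA & _ & _); intros HK Hs.
  destruct (generic_extension is_interval c
    (fun m c' => forces c' (visits A (ball M) m))) as (u & Hu & Hgen).
  - exact countable_nat.
  - exact is_interval_inhabited.
  - exact HK.
  - intros m c' HK' Hs'.
    destruct (returns c' m HK' (stronger_trans _ _ _ Hs' Hs)) as (u & Hu & Hm).
    destruct (force_open c' u (visits A (ball M) m)) as (d & Ha & Hd & Hf & _);
      [now apply takes_value_open|exact Hu|exact Hm|].
    exists d; rewrite Ha; auto.
  - exists u; split; [exact Hu|intros m].
    destruct (Hgen m) as (c' & _ & _ & Hc' & Hf); exact (Hf u Hc').
Qed.

(** Wherever the inner sequence cannot leave [nbhd w] within the ball, it has
    its cluster point there, and this may be named with prefix [w]. *)
Lemma trapped_not_excludes (c : cond) (a b lo hi : R) (w : list nat) (m : nat) :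
  stronger c c0 -> allowed c = in_range a b -> (a <= lo < hi /\ hi <= b)%R ->
  forces c (fun u => ~ visits A (ball_outside M w) m u) ->
  forces c (fun u => ~ excludes (secured B w) lo hi u).
Proof.
  destruct reduction as (HA & HB & _); intros Hs Ha Hle Htrap u Hu Hex.
  destruct (narrow_excluding (secured B w) c a b lo hi u)
    as (c' & Ha' & Hs' & Hf);
    [now apply secured_continuous|exact Ha|lra|exact Hu|exact Hex|].
  assert (HK : is_interval (allowed c'))
    by (rewrite Ha'; apply is_interval_in_range; lra).
  destruct (returning_extension c' HK (stronger_trans _ _ _ Hs' Hs))
    as (v & Hv & Hret).
  destruct (inner_solution c' v HK Hv) as (k & y & HAk & Hy & Hsol).
  assert (Hw : nbhd w y).
  { apply NNPP; intros Hn.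
    destruct (UCL_R_eventually_near (rational_seq k) y M
      (complementary (nbhd w)) Hy) as [N HN]; [now apply nbhd_closed_set|].
    destruct (proj1 (takes_value_maps A _ v k HA HAk) (Hret (max m N)))
      as (i & Hi & Hball).
    apply (Htrap v (Hs' v Hv)), (takes_value_maps A _ v k HA HAk).
    exists i; split; [lia|split; [exact Hball|apply HN; [lia|exact Hball]]]. }
  destruct (nbhd_name w y Hw) as (r & Hr & Hwr).
  destruct (Hsol r Hr) as (s & HBs & Hvs).
  destruct (secured_takes_value B w _ v r s HB (Hf v Hv) Hwr HBs) as [j Hsep].
  exact (cluster_name_not_separated c' v s lo hi j Ha' Hv Hvs Hsep).
Qed.

Lemma no_forced_returns : ~ is_interval (allowed c0).
Proof.
  destruct reduction as (HA & HB & _); intros (a & b & Hab & Ha0).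
  assert (HK0 : is_interval (in_range a b)) by now apply is_interval_in_range.
  destruct (generic_extension (fun S => S = in_range a b) c0
    (fun wm c => decides c (visits A (ball_outside M (fst wm)) (snd wm))))
    as (u & Hu & Hgen).
  - exact (countable_prod _ _ (countable_list _ countable_nat) countable_nat).
  - intros S ->; now apply is_interval_inhabited.
  - exact Ha0.
  - intros [w m] c Ha Hs.
    destruct (decide_open c (visits A (ball_outside M w) m))
      as (c' & Ha' & Hs' & Hdec); [now apply takes_value_open|].
    exists c'; rewrite Ha'; auto.
  - rewrite <- Ha0 in HK0.
    destruct (inner_solution c0 u HK0 Hu) as (k & y & HAk & Hy & Hsol).
    destruct (interior_name y) as (r & Hr & Hint).
    destruct (Hsol r Hr) as (s & HBs & v & _ & Hv).
    destruct (real_delta_separated s v a b Hv Hab) as (lo & hi & j & Hle & Hsep).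
    destruct (value_secured B u r j (s j) HB (HBs j)) as (w & Hw & Hsec).
    destruct (UCL_R_eventually_near (rational_seq k) y M (nbhd w) Hy (Hint w Hw))
      as [m Hm].
    destruct (Hgen (w, m)) as (c & Ha & Hs & Hc & [Hesc|Htrap]).
    + destruct (proj1 (takes_value_maps A _ u k HA HAk) (Hesc u Hc))
        as (i & Hi & Hball & Hout).
      exact (Hout (Hm i Hi Hball)).
    + apply (trapped_not_excludes c a b lo hi w m Hs Ha Hle Htrap u Hc).
      now exists j, (s j).
Qed.

End ForcedReturns.

Lemma dense_below_leaves_ball (M : R) (c0 : cond) :
  dense_below is_interval c0
    (fun c => exists m, forces c (fun u => ~ visits A (ball M) m u)).
Proof.
  intros c HK _; apply NNPP; intros Hno.
  apply (no_forced_returns M c); [|exact HK].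
  intros c' m HK' Hs; apply NNPP; intros Hn; apply Hno.
  exists c'; split; [exact HK'|split; [exact Hs|exists m]].
  intros u Hu Hm; apply Hn; now exists u.
Qed.

End UniqueCluster.

Lemma BWT_R_not_reducible_to_UCL_R :
  ~ continuously_reduces (on_rationals BWT_R) (on_rationals UCL_R).
Proof.
  intros (A & B & Hred); pose proof Hred as (HA & _ & _).
  pose (c0 := Cond nil (in_range 0 1)).
  assert (HK : is_interval (allowed c0)) by (apply is_interval_in_range; lra).
  destruct (generic_extension is_interval c0 (fun N c =>
    exists m, forces c (fun u => ~ visits A (ball (INR N)) m u)))
    as (u & Hu & Hgen).
  - exact countable_nat.
  - exact is_interval_inhabited.
  - exact HK.
  - intros N; exact (dense_below_leaves_ball A B Hred (INR N) c0).
  - destruct (inner_solution A B Hred c0 u HK Hu) as (k & y & HAk & [Hy _] & _).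
    destruct (INR_unbounded (Rabs y + 1)) as [N HN].
    destruct (Hgen N) as (c & _ & _ & Hc & m & Hm).
    apply (Hm u Hc), (takes_value_maps A _ u k HA HAk).
    apply (Hy (ball (INR N)) m), neighbourhood_iff; exists 1%R.
    split; [lra|intros z Hz; unfold ball; split_Rabs; lra].
Qed.

(** * The separations *)

Definition asymptotic (x z : nat -> R) : Prop := Un_cv (fun i => x i - z i)%R 0.

Definition asymptotic_invariant (f : limit_problem) : Prop :=
  forall (x z : nat -> R) (y : R), asymptotic x z -> f x y -> f z y.

Lemma asymptotic_sym (x z : nat -> R) :
  asymptotic x z -> asymptotic z x.
Proof.
  intros H eps Heps; destruct (H eps Heps) as [N HN]; exists N; intros n Hn.
  specialize (HN n Hn); unfold Rdist in *; rewrite Rminus_0_r in *.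
  now rewrite Rabs_minus_sym.
Qed.

Lemma ValAdh_asymptotic (x z : nat -> R) (y : R) :
  asymptotic x z -> ValAdh x y -> ValAdh z y.
Proof.
  rewrite !ValAdh_iff; intros Hxz Hx eps Heps N.
  destruct (Hxz (eps / 2)%R) as [N' HN']; [lra|].
  destruct (Hx (eps / 2)%R ltac:(lra) (max N N')) as (n & Hn & Hxn).
  exists n; split; [lia|]; specialize (HN' n ltac:(lia)).
  unfold Rdist in HN'; split_Rabs; lra.
Qed.

Lemma BWT_R_asymptotic : asymptotic_invariant BWT_R.
Proof.
  intros x z y Hxz [[M HM] Hy].
  split; [|exact (ValAdh_asymptotic x z y Hxz Hy)].
  destruct (maj_by_pos _ (exist _ 0%R Hxz)) as (M' & _ & HM').
  exists (M + M')%R; intros n; specialize (HM n); specialize (HM' n).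
  split_Rabs; lra.
Qed.

Lemma UCL_R_asymptotic : asymptotic_invariant UCL_R.
Proof.
  intros x z y Hxz [Hy Huniq]; split; [exact (ValAdh_asymptotic x z y Hxz Hy)|].
  intros v Hv; apply Huniq; revert Hv; now apply ValAdh_asymptotic, asymptotic_sym.
Qed.

Lemma diagonal_asymptotic (k : baire) (x : nat -> R) :
  seq_delta real_space k x -> asymptotic (rational_seq (fun i => k ⟨i, i⟩)) x.
Proof.
  intros Hk; apply Un_cv_inv_pow2; intros i; rewrite Rminus_0_r.
  exact (real_delta_error _ _ i (Hk i)).
Qed.

Lemma continuously_reduces_on_rationals
    (F : problem) (f : limit_problem) :
  asymptotic_invariant f ->
  continuously_reduces F (naming f) -> continuously_reduces F (on_rationals f).
Proof.
  intros Hf; apply (continuously_reduces_reindex _ _ _ (fun i => ⟨i, i⟩)).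
  intros k (_ & x & y & Hk & Hy & _); pose proof (diagonal_asymptotic k x Hk) as Hd.
  split.
  - apply on_rationals_solvable; exists y; revert Hy.
    now apply Hf, asymptotic_sym.
  - intros r (y' & Hy' & Hr); exists x, y'.
    split; [exact Hk|split; [exact (Hf _ _ _ Hd Hy')|exact Hr]].
Qed.

Definition const_names (u : baire) : baire := fun n => u (fst (Cantor.of_nat n)).

Lemma const_names_pair (u : baire) (i j : nat) : const_names u ⟨i, j⟩ = u i.
Proof. unfold const_names; now rewrite Cantor.cancel_of_to. Qed.

Lemma const_names_agree (l : nat) (u u' : baire) :
  agree l u u' -> agree l (const_names u) (const_names u').
Proof.
  intros Hu n Hn; apply Hu.
  destruct (Cantor.of_nat n) as [i j] eqn:Hij; simpl.
  pose proof (Cantor.to_nat_non_decreasing i j) as Hle.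
  rewrite <- Hij, Cantor.cancel_to_of in Hle; lia.
Qed.

Lemma const_names_seq (X : repspace) (u : baire) (x : nat -> X) :
  (forall i, delta (fun _ => u i) (x i)) -> seq_delta X (const_names u) x.
Proof.
  intros Hx i; replace (fun j => const_names u ⟨i, j⟩) with (fun _ : nat => u i).
  - apply Hx.
  - apply functional_extensionality; intros j; symmetry; apply const_names_pair.
Qed.

Lemma on_rationals_reduces_to (f : limit_problem) (G : problem) :
  continuously_reduces (naming f) G -> continuously_reduces (on_rationals f) G.
Proof.
  apply (continuously_reduces_encode _ _ _ const_names); [apply const_names_agree|].
  intros u Hu; apply on_rationals_solvable in Hu.
  assert (Hname : delta (r := seq_space real_space) (const_names u)
    (rational_seq u)) by (apply const_names_seq; intros i; apply real_delta_const).
  split; [now apply (naming_solvable f _ _ Hname)|].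
  intros s Hs; exact (naming_at f _ _ _ Hname Hs).
Qed.

Lemma CL_N_not_le_BWT_R : ~ (CL_N ≤W BWT_R).
Proof.
  intros Hle.
  apply (recurrent_number_not_reducible_to_BWT_R 0 (fun n => n));
    [intros n; now exists n|].
  apply continuously_reduces_on_rationals; [exact BWT_R_asymptotic|].
  apply (continuously_reduces_encode (naming CL_N) _ _ const_names);
    [exact const_names_agree| |now apply weihrauch_le_continuously_reduces].
  intros u (s0 & Hs0).
  assert (Hname : delta (r := seq_space nat_space) (const_names u) u)
    by now apply const_names_seq.
  split.
  - apply (naming_solvable CL_N _ _ Hname); exists (s0 0); apply Hs0.
  - intros s Hs; destruct (naming_at CL_N _ _ _ Hname Hs) as (n & Hn & <-).
    destruct Hs0 as [Hrec Huniq]; split; [exact Hn|].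
    intros m Hm; now rewrite (Huniq m Hm), (Huniq _ Hn).
Qed.

Definition nat_index (n : nat) : nat := ⟨⟨n, 0⟩, 0⟩.

Lemma ratR_nat_index (n : nat) : ratR (nat_index n) = INR n.
Proof.
  unfold ratR, rat, nat_index; rewrite !Cantor.cancel_of_to; unfold Q2R; simpl.
  rewrite Z.sub_0_r, INR_IZR_INZ; field.
Qed.

Definition nearest_nat (b : nat) : nat := Z.to_nat (up (ratR b - / 2)).

Lemma nearest_nat_spec (b n : nat) :
  (Rabs (ratR b - INR n) < / 2)%R -> nearest_nat b = n.
Proof.
  intros Hb; unfold nearest_nat; rewrite <- (tech_up (ratR b - / 2) (Z.of_nat n)).
  - apply Nat2Z.id.
  - rewrite <- INR_IZR_INZ; split_Rabs; lra.
  - rewrite <- INR_IZR_INZ; split_Rabs; lra.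
Qed.

Lemma UCL_R_INR (u : nat -> nat) (c : nat) :
  UCL_N u c -> UCL_R (fun i => INR (u i)) (INR c).
Proof.
  intros [Hc Huniq]; split; [apply ValAdh_INR; now exists c|].
  intros z Hz; apply ValAdh_INR in Hz as (n & -> & Hn); now rewrite (Huniq n Hn).
Qed.

Lemma UCL_R_not_le_BWT_R : ~ (UCL_R ≤W BWT_R).
Proof.
  intros Hle; apply (recurrent_number_not_reducible_to_BWT_R 2 nearest_nat).
  { intros n; exists (nat_index n); apply nearest_nat_spec.
    rewrite ratR_nat_index, Rminus_diag, Rabs_R0; lra. }
  apply continuously_reduces_on_rationals; [exact BWT_R_asymptotic|].
  apply (continuously_reduces_encode (naming UCL_R) _ _
    (fun u => const_names (fun i => nat_index (u i))));
    [intros l u u' Hu; apply const_names_agree; intros m Hm; now rewrite Hu| |].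
  - intros u (s0 & Hs0); set (c := nearest_nat (s0 2)) in Hs0.
    pose proof (UCL_R_INR u c Hs0) as Hsol.
    assert (Hname : delta (r := seq_space real_space)
      (const_names (fun i => nat_index (u i))) (fun i => INR (u i))).
    { apply const_names_seq; intros i; rewrite <- ratR_nat_index.
      apply real_delta_const. }
    split; [apply (naming_solvable UCL_R _ _ Hname); now exists (INR c)|].
    intros s Hs; destruct (naming_at UCL_R _ _ _ Hname Hs) as (y & [Hy _] & Hsy).
    rewrite (proj2 Hsol y Hy) in Hsy.
    unfold recurrent_number; rewrite (nearest_nat_spec (s 2) c); [exact Hs0|].
    pose proof (real_delta_error s (INR c) 2 Hsy); simpl in *; lra.
  - now apply weihrauch_le_continuously_reduces.
Qed.

Lemma BWT_R_not_le_UCL_R : ~ (BWT_R ≤W UCL_R).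
Proof.
  intros Hle; apply BWT_R_not_reducible_to_UCL_R.
  apply on_rationals_reduces_to, continuously_reduces_on_rationals;
    [exact UCL_R_asymptotic|now apply weihrauch_le_continuously_reduces].
Qed.

Lemma BWT_R_not_le_CL_N : ~ (BWT_R ≤W CL_N).
Proof.
  intros Hle.
  apply (BWT_R_not_reducible_to_countably_many_answers (naming CL_N)
    (fun n _ => n)).
  - intros k (q & u & n & Hk & Hn & _); exists n, u, n; now split.
  - apply on_rationals_reduces_to; now apply weihrauch_le_continuously_reduces.
Qed.

Theorem theorem12p4 :
  ~ (UCL_R ≤W BWT_R) /\ ~ (BWT_R ≤W UCL_R) /\
  ~ (CL_N ≤W BWT_R) /\ ~ (BWT_R ≤W CL_N).
Proof.
  split; [exact UCL_R_not_le_BWT_R|split; [exact BWT_R_not_le_UCL_R|]].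
  split; [exact CL_N_not_le_BWT_R|exact BWT_R_not_le_CL_N].
Qed.
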